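(* Let $q$ be a prime power, $n\ge2$, and $0<k<n$. Let $\mathcal U_{k,n}(q)$ be the uniform $q$-matroid of rank $k$ on $\mathbb F_q^n$. Then there is no positive integer $m<n$ such that $\mathcal U_{k,n}(q)$ is $\mathbb F_q^{n\times m}$-representable.
   Context: Let $E=\mathbb F_q^n$ and $\mathcal L(E)$ the set of its $\mathbb F_q$-subspaces. $\mathcal U_{k,n}(q)=(\mathcal L(E),\rho)$ with $\rho(V)=\min\{k,\dim V\}$. For an $\mathbb F_q$-linear subspace $\mathcal C\subseteq\mathbb F_q^{n\times m}$ of dimension $k'$, set $\mathcal C(W)=\{M\in\mathcal C:\operatorname{colsp}_{\mathbb F_q}(M)\subseteq W\}$ and $\rho_{\mathcal C}(U)=(k'-\dim\mathcal C(U^\perp))/m$, with $U^\perp$ the orthogonal complement under the standard dot product. A $q$-matroid $(\mathcal L(E),\rho)$ is $\mathbb F_q^{n\times m}$-representable if $\rho=\rho_{\mathcal C}$ for some such $\mathcal C$. *)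

(* Defs.v *)
From mathcomp Require Import all_boot all_order all_algebra.
From mathcomp Require Import zify.

Set Implicit Arguments.
Unset Strict Implicit.
Unset Printing Implicit Defensive.

Import Order.TTheory GRing.Theory Num.Theory.
Local Open Scope ring_scope.

(* The integer-valued rank axioms of Jurrius and Pellikaan. *)
Record qmatroid (F : finFieldType) (n : nat) := QMatroid {
  qrank :> {vspace 'cV[F]_n} -> nat;
  qrank_dim : forall U, (qrank U <= \dim U)%N;
  qrank_mono : forall U V, (U <= V)%VS -> (qrank U <= qrank V)%N;
  qrank_submod : forall U V,
    (qrank (U + V)%VS + qrank (U :&: V)%VS <= qrank U + qrank V)%N
}.

Section Uniform.
Variables (F : finFieldType) (n k : nat).
Implicit Types U V : {vspace 'cV[F]_n}.

Definition uniform_rank U := minn k (\dim U).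

Fact uniform_rank_dim U : (uniform_rank U <= \dim U)%N.
Proof. exact: geq_minr. Qed.

Fact uniform_rank_mono U V :
  (U <= V)%VS -> (uniform_rank U <= uniform_rank V)%N.
Proof. by move=> /dimvS; rewrite /uniform_rank; lia. Qed.

Fact uniform_rank_submod U V :
  (uniform_rank (U + V)%VS + uniform_rank (U :&: V)%VS
     <= uniform_rank U + uniform_rank V)%N.
Proof.
have := dimv_add_leqif U V; have := dimv_sum_cap U V.
have := dimvS (capvSl U V); have := dimvS (capvSr U V).
by rewrite /uniform_rank => *; lia.
Qed.

Definition uniform_qmatroid : qmatroid F n :=
  QMatroid uniform_rank_dim uniform_rank_mono uniform_rank_submod.

End Uniform.

Section Codes.
Variable F : finFieldType.

(* Spanning an enumerated set turns a set-builder description of a subspace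
   into a {vspace _}; mem_span_enum shows that nothing is added. *)
Lemma mem_span_enum (a b : nat) (P : pred 'M[F]_(a, b)) :
  P (0 : 'M[F]_(a, b)) -> (forall (c : F) u v, P u -> P v -> P (c *: u + v)) ->
  forall v, (v \in <<enum P>>%VS) = P v.
Proof.
move=> P0 PD v; apply/idP/idP => [/coord_span -> | Pv]; last first.
  by apply: memv_span; rewrite mem_enum.
apply: (big_ind P) => // [x y Px Py|i _].
  by rewrite -[x]scale1r; apply: PD.
rewrite -[_ *: _]addr0; apply: PD => //.
have : (enum P)`_i \in enum P by apply: mem_nth; rewrite -cardE; case: i.
by rewrite mem_enum.
Qed.

Definition dot (n : nat) (u v : 'cV[F]_n) : F := \sum_(i < n) u i 0 * v i 0.

Definition orthov (n : nat) (U : {vspace 'cV[F]_n}) : {vspace 'cV[F]_n} :=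
  <<enum [pred v | [forall u in U, dot u v == 0%R]]>>%VS.

Lemma orthovP (n : nat) (U : {vspace 'cV[F]_n}) (v : 'cV[F]_n) :
  reflect (forall u, u \in U -> dot u v = 0) (v \in orthov U).
Proof.
rewrite mem_span_enum /= => [||c x y /forall_inP Hx /forall_inP Hy].
- by apply: (iffP forall_inP) => H u /H /eqP.
- by apply/forall_inP => u _; rewrite /dot big1 // => i _; rewrite mxE mulr0.
apply/forall_inP => u uU; apply/eqP.
transitivity (c * dot u x + dot u y); last first.
  by rewrite (eqP (Hx u uU)) (eqP (Hy u uU)) mulr0 addr0.
rewrite /dot mulr_sumr -big_split; apply: eq_bigr => i _ /=.
by rewrite !mxE mulrDr mulrCA.
Qed.

Variables n m : nat.

Definition colsp (M : 'M[F]_(n, m)) : {vspace 'cV[F]_n} :=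
  <<[seq col j M | j : 'I_m]>>%VS.

Definition subcode (C : {vspace 'M[F]_(n, m)}) (W : {vspace 'cV[F]_n}) :
    {vspace 'M[F]_(n, m)} :=
  <<enum [pred M | (M \in C) && (colsp M <= W)%VS]>>%VS.

Lemma colsp_subP (M : 'M[F]_(n, m)) (W : {vspace 'cV[F]_n}) :
  reflect (forall j, col j M \in W) (colsp M <= W)%VS.
Proof.
apply: (iffP span_subvP) => [H j | H _ /imageP[j _ ->]]; last exact: H.
by apply: H; apply: image_f.
Qed.

Lemma mem_subcode (C : {vspace 'M[F]_(n, m)}) (W : {vspace 'cV[F]_n}) M :
  (M \in subcode C W) = (M \in C) && (colsp M <= W)%VS.
Proof.
rewrite mem_span_enum //=.
  rewrite mem0v; apply/colsp_subP => j.
  by rewrite (_ : col j 0 = 0) ?mem0v //; apply/matrixP => i l; rewrite !mxE.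
move=> c A B /andP[AC /colsp_subP AW] /andP[BC /colsp_subP BW].
rewrite memvD ?memvZ //=; apply/colsp_subP => j.
rewrite (_ : col j _ = c *: col j A + col j B) ?memvD ?memvZ //.
by apply/matrixP => i l; rewrite !mxE.
Qed.

Definition code_rank (C : {vspace 'M[F]_(n, m)}) (U : {vspace 'cV[F]_n}) : rat :=
  ((\dim C)%:R - (\dim (subcode C (orthov U)))%:R) / m%:R.

End Codes.

Definition representable (F : finFieldType) (n m : nat) (M : qmatroid F n) : Prop :=
  exists C : {vspace 'M[F]_(n, m)},
    forall U : {vspace 'cV[F]_n}, (M U)%:R = code_rank C U.

(* Main.v *)
(* Representability forces dim C = k m and makes every nonzero matrix of C have
   rank greater than n - k. Hence deleting n - k columns is injective on C, so
   k m <= n (m - (n - k)), which is impossible for m < n (this is the Singleton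
   bound for rank-metric codes). *)
From mathcomp Require Import all_boot all_order all_algebra.
From mathcomp Require Import zify.
Require Import Defs.

Set Implicit Arguments.
Unset Strict Implicit.
Unset Printing Implicit Defensive.

Import GRing.Theory Num.Theory.
Local Open Scope ring_scope.

(** The witness is the kernel of [(col_base M)^T], the orthogonal complement of the column space;
    rank-nullity bounds its dimension. *)
Lemma colsp_sub_orthov (F : finFieldType) (n m : nat) (M : 'M[F]_(n, m)) :
  exists2 U : {vspace 'cV[F]_n},
    (n - \rank M <= \dim U)%N & (colsp M <= orthov U)%VS.
Proof.
pose f := linfun (mulmx (col_base M)^T : 'cV[F]_n -> 'cV_(\rank M)).
exists (lker f).
  have := limg_ker_dim f fullv; have := dimvS (subvf (limg f)).
  rewrite capfv !dimvf /dim /= !muln1 leq_subLR => le_im dim_f.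
  by rewrite -[X in (X <= _)%N]dim_f addnC leq_add2r.
apply/colsp_subP => j; apply/orthovP => u; rewrite memv_ker lfunE /= => /eqP u0.
have /matrixP/(_ j 0) : M^T *m u = 0.
  by rewrite -{1}(mulmx_base M) trmx_mul -mulmxA u0 mulmx0.
by rewrite !mxE => <-; apply: eq_bigr => i _; rewrite !mxE mulrC.
Qed.

Lemma subcode_orthov_fullv (F : finFieldType) (n m : nat)
    (C : {vspace 'M[F]_(n, m)}) : subcode C (orthov fullv) = 0%VS.
Proof.
apply/eqP; rewrite -subv0; apply/subvP => M.
rewrite mem_subcode memv0 => /andP[_ /colsp_subP MW].
(* Pairing column [j] with the [i]-th standard vector extracts the entry [M i j]. *)
apply/eqP/matrixP => i j; have /orthovP/(_ _ (memvf (delta_mx i 0))) := MW j.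
rewrite /dot (bigD1 i) //= big1 => [|l /negPf li]; last first.
  by rewrite !mxE li mul0r.
by rewrite !mxE !eqxx mul1r addr0.
Qed.

Lemma code_rank_fullv (F : finFieldType) (n m : nat)
    (C : {vspace 'M[F]_(n, m)}) : code_rank C fullv = (\dim C)%:R / m%:R.
Proof. by rewrite /code_rank subcode_orthov_fullv dimv0 subr0. Qed.

(** Multiplication by [P] keeps the first [m - r] columns. A matrix it kills has rank at most [r],
    so the map is injective on [C]. If [r >= m], the target is zero. *)
Lemma singleton_bound (F : finFieldType) (n m r : nat)
    (C : {vspace 'M[F]_(n, m)}) :
  (forall M, M \in C -> (\rank M <= r)%N -> M = 0) ->
  (\dim C <= n * (m - r))%N.
Proof.
move=> Crank; pose P : 'M[F]_(m, m - r) := pid_mx (m - r).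
pose f := linfun (mulmxr P : 'M[F]_(n, m) -> 'M_(n, m - r)).
rewrite -(@limg_dim_eq _ _ _ f C).
  by have := dimvS (subvf (f @: C)); rewrite dimvf.
apply/eqP; rewrite -subv0; apply/subvP => M.
rewrite memv_cap memv_ker lfunE /= memv0 => /andP[MC /eqP MP0].
apply/eqP/Crank => //.
by have := mulmx0_rank_max MP0; rewrite rank_pid_mx ?leq_subr //; lia.
Qed.

Theorem theorem4p1 (F : finFieldType) (n k : nat)
    (hn : (2 <= n)%N) (hk : (0 < k < n)%N) :
  ~ exists m : nat, (0 < m < n)%N /\ representable m (uniform_qmatroid F n k).
Proof.
case=> m [/andP[m0 mn] [C HC]]; case/andP: hk => k0 kn.
have mN0 : m%:R != 0 :> rat by rewrite pnatr_eq0 -lt0n.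
have rankf U : (k <= \dim U)%N -> code_rank C U = k%:R.
  by move=> kU; rewrite -HC /= /uniform_rank (minn_idPl kU).
have dimC : \dim C = (k * m)%N.
  have := rankf fullv; rewrite dimvf /dim /= muln1 code_rank_fullv => /(_ (ltnW kn)).
  by move/(canRL (divfK mN0))/eqP; rewrite -natrM eqr_nat => /eqP.
have : (\dim C <= n * (m - (n - k)))%N.
  apply: singleton_bound => M MC Mr.
  have [U dimU MU] := colsp_sub_orthov M.
  (* Since [U] and [fullv] both have rank [k], cancellation leaves [subcode C (orthov U)] of
     dimension zero, and [M] lies in it. *)
  have := rankf U; rewrite -(rankf fullv) ?code_rank_fullv /code_rank; last first.
    by rewrite dimvf /dim /= muln1 ltnW.
  have kU : (k <= \dim U)%N by lia.
  move=> /(_ kU)/(divIf mN0)/eqP.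
  rewrite subr_eq addrC -subr_eq subrr eq_sym pnatr_eq0 dimv_eq0 => /eqP S0.
  by apply/eqP; rewrite -memv0 -S0 mem_subcode MC.
(* If [m <= n - k], the right side truncates to 0 while [k * m > 0]; otherwise it falls short of
   [k * m] by [(n - k) * (n - m) > 0]. *)
rewrite dimC; nia.
Qed.
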